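(* There is an absolute constant $K>0$ such that for every odd prime $p$ and every integer $a$ with $p\nmid a$, $$\left|\sum_{b=1}^{p-1}\sum_{c=1}^{p-1}\left(\frac{b^2-a^2c^2}{p}\right)\left(\frac{b^2-1}{p}\right)\left(\frac{c^2-1}{p}\right)\right|\le K\,p.$$
   Context: $\left(\frac{\cdot}{p}\right)$ denotes the Legendre symbol modulo $p$ (with $\left(\frac{0}{p}\right)=0$). *)

(* Defs.v *)
From HB Require Import structures.
From mathcomp Require Import all_boot all_order all_algebra.
Set Implicit Arguments. Unset Strict Implicit. Unset Printing Implicit Defensive.
Import Order.TTheory GRing.Theory Num.Theory.
Local Open Scope ring_scope.

Definition legendre (a : int) (p : nat) : int :=
  if (p%:Z %| a)%Z then 0
  else if [exists x : 'I_p, (p%:Z %| (x%:Z) ^+ 2 - a)%Z] then 1 else -1.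

(* Main.v *)
Require Import Defs.
From HB Require Import structures.
From mathcomp Require Import all_boot all_order all_algebra all_field.
From mathcomp Require Import ring zify.
Import Order.TTheory GRing.Theory Num.Theory.
Local Open Scope ring_scope.

(** Put [A = a ^ 2]. Substituting [x = b ^ 2], [y = c ^ 2] gives the factor
    [(1 + chi x) (1 + chi y)]; of the four resulting sums all but the one with
    [chi (x y)] collapse, because one of the variables then runs over a quadratic
    polynomial. The remaining sum of [chi (x y (x - 1) (y - 1) (x - A y))] is,
    by a finite field analogue of Clausen's formula, up to sign [t ^ 2 + O(p)], with
    [t] the sum of [chi ((x - m) (x ^ 2 - c))] for any [c <> 0] and
    [m ^ 2 = (1 - A) c]. Finally [t = O(sqrt p)] by Stepanov's method: an
    auxiliary polynomial in [X], [f ^ ((p - 1) / 2)] and [X ^ p] of small degree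
    vanishes to high order wherever [chi (f x)] takes a given value. *)

(** * The quadratic character of a finite field *)

Definition quadchar (F : finFieldType) (x : F) : int :=
  if x == 0 then 0 else if [exists y, y ^+ 2 == x] then 1 else -1.

Lemma quadchar_norm_le1 (F : finFieldType) (x : F) : `|quadchar F x| <= 1.
Proof. by rewrite /quadchar; case: eqP => // _; case: ifP. Qed.

Lemma quadchar0 (F : finFieldType) : quadchar F 0 = 0.
Proof. by rewrite /quadchar eqxx. Qed.

Lemma quadchar_sqr (F : finFieldType) (x : F) : x != 0 -> quadchar F (x ^+ 2) = 1.
Proof.
move=> x0; rewrite /quadchar sqrf_eq0 (negPf x0); case: existsP => // -[].
by exists x.
Qed.

Lemma quadchar_eq1 (F : finFieldType) (x : F) :
  (quadchar F x == 1) = (x != 0) && [exists y, y ^+ 2 == x].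
Proof. by rewrite /quadchar; case: (x == 0) => //; case: ifP. Qed.

Section QuadraticCharacter.
Variable F : finFieldType.
Hypothesis two_neq0 : 2%:R != 0 :> F.
Local Notation chi := (quadchar F).
Local Notation q := (#|F|%:R : int).
Implicit Types x y : F.

Lemma card_sqrt x : (#|[pred y : F | y ^+ 2 == x]|)%:R = 1 + chi x.
Proof.
rewrite /quadchar; case: eqP => [->|/eqP x0].
  by rewrite (@eq_card1 _ 0) // => y; rewrite inE sqrf_eq0 !inE.
case: existsP => [[y /eqP yx]|nsq]; last first.
  rewrite eq_card0 // => y; rewrite !inE; apply/negP => yx; apply: nsq.
  by exists y.
have y0 : y != 0 by apply: contraNneq x0 => y0; rewrite -yx y0 expr0n.
have yN : y != - y.
  by rewrite -subr_eq0 opprK -mulr2n -mulr_natr mulf_neq0.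
rewrite (@eq_card _ _ (pred2 y (- y))) ?card2 ?yN // => z.
by rewrite !inE -yx eqf_sqr.
Qed.

Lemma sum_sqr (g : F -> int) : \sum_b g (b ^+ 2) = \sum_x (1 + chi x) * g x.
Proof.
rewrite (partition_big (fun b => b ^+ 2) predT) //=; apply: eq_bigr => x _.
rewrite (eq_bigr (fun=> g x)) => [|b /eqP->//].
by rewrite sumr_const -card_sqrt mulr_natl.
Qed.

Lemma sum_quadchar : \sum_x chi x = 0.
Proof.
have := sum_sqr (fun=> 1).
under [RHS]eq_bigr do rewrite mulr1.
by rewrite big_split /= => /eqP; rewrite addrC -subr_eq subrr => /eqP <-.
Qed.

Lemma sum_indicator (P : pred F) : \sum_x ((P x)%:R : int) = #|P|%:R.
Proof.
rewrite -sum1_card natr_sum [RHS]big_mkcond; apply: eq_bigr => x _.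
by rewrite unfold_in; case: (P x).
Qed.

(** Sum [1 + chi x] over the field: it is 1 at zero, 2 at a nonzero square, 0 elsewhere. *)
Lemma card_finField_half : #|F| = (#|[pred x : F | chi x == 1]|).*2.+1.
Proof.
have E x : (1 + chi x) = (x == 0)%:R + 2 * (chi x == 1)%:R.
  by rewrite /quadchar; case: eqP => //= _; case: ifP.
have S : q = \sum_x (1 + chi x).
  by rewrite big_split /= sum_quadchar addr0 sumr_const.
apply/eqP; rewrite -(eqr_nat int) S (eq_bigr _ (fun x _ => E x)) big_split /=.
rewrite -big_distrr /= !sum_indicator (@card1 _ 0) !natz.
rewrite (@eq_card _ _ [pred x : F | chi x == 1]) //; apply/eqP; lia.
Qed.

Lemma quadchar_euler x : (chi x)%:~R = x ^+ #|F|./2.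
Proof.
set S := [pred x : F | chi x == 1].
have qE : #|F| = #|S|.*2.+1 := card_finField_half.
have -> : (#|F|./2 = #|S|)%N by rewrite qE /= uphalf_double.
have q1 : (1 < #|F|)%N := finNzRing_gt1 F.
have M0 : (0 < #|S|)%N by lia.
have sq1 y : y != 0 -> y ^+ #|S|.*2 = 1.
  by move=> y0; apply: (mulfI y0); rewrite -exprS -qE expf_card mulr1.
rewrite /quadchar; case: eqP => [->|/eqP x0]; first by rewrite expr0n; case: #|S| M0.
case: existsP => [[y /eqP yx]|nsq].
  by rewrite -yx -exprM mul2n sq1 //; apply: contraNneq x0 => y0; rewrite -yx y0 expr0n.
have : (x ^+ #|S|) ^+ 2 == 1 by rewrite -exprM muln2 sq1.
rewrite sqrf_eq1 => /orP[/eqP x1|/eqP-> //].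
(* The nonzero squares already give [#|S|] roots of [X ^ #|S| - 1]; a nonsquare root would be one
   too many. *)
suff : (size (x :: enum S) <= #|S|)%N by rewrite /= -cardE ltnn.
pose P := 'X^#|S| - 1%:P : {poly F}.
have sP : size P = #|S|.+1 by rewrite size_XnsubC.
rewrite -ltnS -sP; apply: max_poly_roots.
- by rewrite -size_poly_eq0 sP.
- rewrite /= rootE !hornerE x1 subrr eqxx /=; apply/allP => y.
  rewrite mem_enum inE quadchar_eq1 => /andP[y0 /existsP[z /eqP zy]]; rewrite rootE !hornerE -zy -exprM mul2n.
  by rewrite sq1 ?subrr //; apply: contraNneq y0 => z0; rewrite -zy z0 expr0n.
- rewrite /= enum_uniq andbT mem_enum inE quadchar_eq1 x0.
  by apply/existsP.
Qed.

(** Euler's criterion gives the identity in [F]; it lifts to [int] because -1, 0 and 1 stay distinct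
    when [2 != 0]. *)
Lemma quadcharM x y : chi (x * y) = chi x * chi y.
Proof.
have chiV z : [\/ chi z = 0, chi z = 1 | chi z = -1].
  rewrite /quadchar; case: eqP => _; first by constructor.
  by case: ifP => _; [apply: Or32 | apply: Or33].
have : (chi (x * y))%:~R = (chi x * chi y)%:~R :> F.
  by rewrite intrM !quadchar_euler exprMn.
have one0 := oner_neq0 F; have oneN : 1 != -1 :> F.
  by rewrite -subr_eq0 opprK -mulr2n.
case: (chiV (x * y)) (chiV x) (chiV y) => -> [] -> [] -> //= /eqP;
rewrite ?(mulr0, mul0r, mulr1, mul1r, mulrN1, opprK, rmorphN1, rmorph1, rmorph0) //;
by rewrite ?(oppr_eq0, oppr_eq0, negPf one0, negPf oneN, eq_sym 0) // eq_sym
  ?(negPf oneN) ?oppr_eq0 ?(negPf one0).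
Qed.

Lemma quadchar_mulsq x y : x != 0 -> chi (x ^+ 2 * y) = chi y.
Proof. by move=> x0; rewrite quadcharM quadchar_sqr ?mul1r. Qed.

Lemma sum_quadchar_quadratic_norm (a b : F) :
  `|\sum_x chi ((x - a) * (x - b))| <= if a == b then q else 1.
Proof.
case: eqP => [_|/eqP ab].
  apply: le_trans (ler_norm_sum _ _ _) _; rewrite -[q]sumr_const.
  by apply: ler_sum => x _; apply: quadchar_norm_le1.
have d0 : a - b != 0 by rewrite subr_eq0.
rewrite (reindex_inj (addIr a)) /=.
(* Pull out the square [x ^ 2]. At [x = 0] the convention [0^-1 = 0] yields [chi 1 = 1] instead of
   0, and the indicator corrects it; the sum is therefore exactly -1. *)
rewrite (eq_bigr (fun x => chi (1 + (a - b) / x) - (x == 0)%:R)); last first.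
  move=> x _; rewrite addrK; have [->|x0] := eqVneq x 0.
    by rewrite mul0r quadchar0 invr0 mulr0 addr0 -(expr1n _ 2) quadchar_sqr ?oner_neq0.
  rewrite subr0 -[RHS](quadchar_mulsq x) //; congr chi; field.
  exact: x0.
rewrite sumrB sum_indicator (@card1 _ 0).
rewrite (reindex_inj invr_inj) (reindex_inj (mulfI (invr_neq0 d0))) /=.
rewrite (eq_bigr (fun x => chi (1 + x))); last first.
  by move=> x _; rewrite invrK mulrA divff ?mul1r.
have := sum_quadchar; rewrite (reindex_inj (addrI 1)) /= => ->.
by [].
Qed.
End QuadraticCharacter.

(** * A finite field Clausen formula, with error terms *)

Section DoubleSums.
Variable F : finFieldType.
Hypothesis two_neq0 : 2%:R != 0 :> F.
Local Notation chi := (quadchar F).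
Local Notation q := (#|F|%:R : int).
Implicit Types x y z m c e v w A : F.

Lemma sum_norm_le (h : F -> int) (n : int) :
  (forall x, `|h x| <= n) -> `|\sum_x h x| <= n * q.
Proof.
move=> hn; apply: le_trans (ler_norm_sum _ _ _) _.
by rewrite mulr_natr -sumr_const; apply: ler_sum.
Qed.

Lemma quadcharM_norm_le x (s : int) : `|chi x * s| <= `|s|.
Proof. by rewrite normrM ler_piMl ?quadchar_norm_le1. Qed.

(* The substitution [y = (z x - c) / (x - z)] comes from
   [(x^2 - c) (y^2 - c) = (x y + c)^2 - c (x + y)^2]. *)
Lemma sum_moebius_dist m c x : x ^+ 2 != c ->
  `|\sum_y chi ((x - m) * (x ^+ 2 - c) * ((y - m) * (y ^+ 2 - c)))
    - \sum_z chi ((z ^+ 2 - c) * ((x - m) * (x - z) * ((z - m) * x + m * z - c)))| <= 1.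
Proof.
move=> xc; have xc0 : x ^+ 2 - c != 0 by rewrite subr_eq0.
(* The pole [z = x] is sent to [-x], the one value the Moebius map omits, so [s] permutes [F]. Only
   this term can differ between the two sums. *)
pose s z := if z == x then - x else (z * x - c) / (x - z).
have sNx z : z != x -> (z * x - c) / (x - z) != - x.
  move=> zx; have d0 : x - z != 0 by rewrite subr_eq0 eq_sym.
  apply: contra_neq xc0 => /(congr1 ( *%R^~ (x - z))); rewrite divfK // => E.
  have -> : x ^+ 2 - c = (z * x - c) - (- x * (x - z)) by ring.
  by rewrite E subrr.
have s_inj : injective s.
  move=> z1 z2; rewrite /s; case: eqP => [->|/eqP z1x]; case: eqP => [->|/eqP z2x] //.
  - by move=> E; move: (sNx _ z2x); rewrite E eqxx.
  - by move=> E; move: (sNx _ z1x); rewrite E eqxx.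
  have d1 : x - z1 != 0 by rewrite subr_eq0 eq_sym.
  have d2 : x - z2 != 0 by rewrite subr_eq0 eq_sym.
  move/eqP; rewrite eqr_div // -subr_eq0 => /eqP E.
  by apply/eqP; rewrite -subr_eq0; apply/eqP/(mulfI xc0); rewrite mulr0 -E; ring.
rewrite (reindex_inj s_inj) /= -sumrB (bigD1 x) //= big1 => [|z zx].
  rewrite /s eqxx addr0 (subrr x) mulr0 mul0r mulr0 quadchar0 subr0.
  exact: quadchar_norm_le1.
apply/eqP; rewrite subr_eq0; apply/eqP.
have d0 : x - z != 0 by rewrite subr_eq0 eq_sym.
rewrite /s (negPf zx) -[RHS](quadchar_mulsq F two_neq0 ((x ^+ 2 - c) / (x - z) ^+ 2)).
  congr chi; field; exact: d0.
by rewrite mulf_neq0 ?invr_neq0 ?expf_neq0.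
Qed.

Lemma sqr_sum_moebius_dist m c :
  `|(\sum_x chi ((x - m) * (x ^+ 2 - c))) ^+ 2
    - \sum_x \sum_z chi ((z ^+ 2 - c) * ((x - m) * (x - z) * ((z - m) * x + m * z - c)))|
  <= 3 * q.
Proof.
have q1 : 1 <= q by rewrite ler1n; apply: ltnW; apply: finNzRing_gt1.
rewrite expr2 big_distrlr /= -sumrB; apply: le_trans (ler_norm_sum _ _ _) _.
(* Each [x] with [x ^ 2 != c] costs at most 1. For the at most two others the row of the square
   vanishes and the Moebius row is at most [q]. In total [q + 2 q]. *)
apply: (@le_trans _ _ (\sum_x (1 + (x ^+ 2 == c)%:R * q))).
  apply: ler_sum => x _.
  under eq_bigr do rewrite -quadcharM //.
  have [xc|xc] := boolP (x ^+ 2 == c); last first.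
    by rewrite mul0r addr0 sum_moebius_dist.
  rewrite big1 => [|y _]; last by rewrite (eqP xc) subrr mulr0 mul0r quadchar0.
  rewrite sub0r normrN; apply: le_trans (sum_norm_le _ 1 _) _ => [z|]; last by rewrite !mul1r lerDr.
  exact: quadchar_norm_le1.
rewrite big_split /= -mulr_suml sumr_const (sum_indicator F (fun x => x ^+ 2 == c)).
rewrite card_sqrt //; have := quadchar_norm_le1 F c; rewrite ler_norml => /andP[_ c1].
by rewrite -{1}[q]mul1r -mulrDl ler_wpM2r ?ler0n //; lia.
Qed.

(* Put [x = m + u], [z = m + w], [v = u / w]; then replace [w] by [1 / w]. *)
Lemma sum_moebius_rescaled_dist m c :
  `|\sum_x \sum_z chi ((z ^+ 2 - c) * ((x - m) * (x - z) * ((z - m) * x + m * z - c)))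
    - \sum_w \sum_v chi (v * (v - 1) * (v + (2%:R * m * w + (m ^+ 2 - c) * w ^+ 2))
                        * (1 + (2%:R * m * w + (m ^+ 2 - c) * w ^+ 2)))|
  <= 2 * q.
Proof.
rewrite exchange_big /= (reindex_inj (addrI m)) /= (reindex_inj invr_inj) /=.
rewrite -sumrB (bigD1 0) //= [X in _ + X]big1 ?addr0 => [|w w0].
  have nb (h : F -> F) : `|\sum_x chi (h x)| <= q.
    by rewrite -[q]mul1r; apply: sum_norm_le => x; apply: quadchar_norm_le1.
  rewrite (_ : 2 * q = q + q); last by lia.
  apply: le_trans (ler_normB _ _) (lerD _ _); exact: nb.
apply/eqP; rewrite subr_eq0; apply/eqP.
rewrite (reindex_inj (addrI m)) (reindex_inj (mulfI (invr_neq0 w0))) /=.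
apply: eq_bigr => v _.
have w3 : w ^+ 3 != 0 by rewrite expf_neq0.
rewrite -[LHS](quadchar_mulsq F two_neq0 (w ^+ 3)) //; congr chi; field; exact: w0.
Qed.

(** Complete the square: [Q = 2 m w + e w ^ 2] means [m ^ 2 + e Q = (m + e w) ^ 2], so [Q] has
    [1 + chi (m ^ 2 + e Q)] preimages. *)
Lemma sum_quadratic_subst m e (g : F -> int) : e != 0 ->
  \sum_w g (2%:R * m * w + e * w ^+ 2) = \sum_Q (1 + chi (m ^+ 2 + e * Q)) * g Q.
Proof.
move=> e0; have eV := invr_neq0 e0.
rewrite [RHS](reindex_inj (mulfI eV)) [RHS](reindex_inj (addIr (- m ^+ 2))) /=.
under [RHS]eq_bigr => s _ do rewrite mulVKf // (addrC (m ^+ 2)) subrK.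
rewrite -(sum_sqr F two_neq0 (fun s => g (e^-1 * (s - m ^+ 2)))).
rewrite [RHS](reindex_inj (mulfI e0)) [RHS](reindex_inj (addIr (m / e))) /=.
apply: eq_bigr => w _; congr g; field; exact: e0.
Qed.

(** After [y -> 1 / y] this is, for [A != 0] and up to the sign [chi A], the finite field analogue
    of the Euler integral of the hypergeometric function 3F2 with parameters 1/2, 1/2, 1/2; 1, 1 at
    [1 / A]. *)
Definition clausen_sum A :=
  \sum_y \sum_x chi (x * y * (x - 1) * (y - 1) * (x - A * y)).

(** For fixed [v] the argument is quadratic in [Q] with roots [-v] and [-1], which coincide only at
    [v = 1]; that single [v] costs [q]. *)
Lemma sum_untwisted_norm_le :
  `|\sum_Q \sum_v chi (v * (v - 1) * (v + Q) * (1 + Q))| <= 2 * q.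
Proof.
rewrite exchange_big /=.
apply: (@le_trans _ _ (\sum_(v : F) (1 + (v == 1)%:R * q))); last first.
  rewrite big_split /= -mulr_suml sumr_const (sum_indicator F (fun v => v == 1)).
  by rewrite (@card1 _ 1) mul1r -mulr2n mulr_natl.
apply: le_trans (ler_norm_sum _ _ _) _; apply: ler_sum => v _.
rewrite (eq_bigr (fun Q => chi (v * (v - 1)) * chi ((Q - - v) * (Q - - 1)))); last first.
  by move=> Q _; rewrite -quadcharM //; congr chi; ring.
rewrite -mulr_sumr; apply: le_trans (quadcharM_norm_le _ _) _.
apply: le_trans (sum_quadchar_quadratic_norm _ two_neq0 _ _) _.
have q1 : 0 <= q by rewrite ler0n.
by rewrite eqr_opp; case: eqP => _; lia.
Qed.

(* The substitution is [y = 1 / (A (1 + Q))], [x = (1 - v) / (1 + Q)]. *)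
Lemma clausen_sum_twisted A c m : A != 0 -> c != 0 -> m ^+ 2 = (1 - A) * c ->
  \sum_Q chi (m ^+ 2 + (m ^+ 2 - c) * Q)
     * \sum_v chi (v * (v - 1) * (v + Q) * (1 + Q))
  = chi (- c) * clausen_sum A.
Proof.
move=> A0 c0 mE; rewrite /clausen_sum mulr_sumr.
rewrite [RHS](reindex_inj invr_inj) [RHS](reindex_inj (mulfI A0)) /=.
rewrite [RHS](reindex_inj (addrI 1)) /=; apply: eq_bigr => Q _.
have [Q0|Q0] := eqVneq (1 + Q) 0.
  by rewrite Q0 !big1 ?mulr0 // => x _; rewrite ?mulr0 ?invr0 ?mulr0 ?mul0r quadchar0.
rewrite [in RHS](reindex_inj (mulfI (invr_neq0 Q0))) [in RHS](reindex_inj (subrI 1)) /=.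
rewrite !mulr_sumr; apply: eq_bigr => v _; rewrite -!quadcharM //.
(* Since [m ^ 2 = (1 - A) c], the twist is [c (1 - A (1 + Q))], which matches the factor [y - 1].
   The two arguments then differ by the square of [A (1 + Q) ^ 3]. *)
have w3 : A * (1 + Q) ^+ 3 != 0 by rewrite mulf_neq0 ?expf_neq0.
rewrite -[RHS](quadchar_mulsq F two_neq0 (A * (1 + Q) ^+ 3)) //.
by congr chi; rewrite mE; field; rewrite Q0 A0.
Qed.

(** The 7 is 3 from the Moebius substitution, 2 from the rescaling and 2 from the untwisted sum; the
    twisted sum is [clausen_sum A] up to sign. *)
Lemma clausen_sum_norm_le A c m : A != 0 -> c != 0 -> m ^+ 2 = (1 - A) * c ->
  `|clausen_sum A| <= (\sum_x chi ((x - m) * (x ^+ 2 - c))) ^+ 2 + 7 * q.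
Proof.
move=> A0 c0 mE.
have e0 : m ^+ 2 - c != 0 by rewrite mE mulrBl mul1r addrC addKr oppr_eq0 mulf_neq0.
have := sqr_sum_moebius_dist m c.
have := sum_moebius_rescaled_dist m c.
rewrite (sum_quadratic_subst m _ (fun Q => \sum_v chi (v * (v - 1) * (v + Q) * (1 + Q)))) //.
under [X in _ - X]eq_bigr do rewrite mulrDl mul1r.
rewrite big_split /= (clausen_sum_twisted A) //.
have := sum_untwisted_norm_le.
have : `|chi (- c) * clausen_sum A| = `|clausen_sum A|.
  rewrite normrM; suff -> : `|chi (- c)| = 1 by rewrite mul1r.
  by rewrite /quadchar oppr_eq0 (negPf c0); case: ifP.
have triangle (S R P X T n : int) : 0 <= T -> `|R| = `|S| -> `|P| <= 2 * n ->
  `|X - (P + R)| <= 2 * n -> `|T - X| <= 3 * n -> `|S| <= T + 7 * n by lia.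
by apply: triangle; apply: sqr_ge0.
Qed.
End DoubleSums.

(** * Reduction of the full sum to the Clausen sum *)

Section FullSum.
Variable F : finFieldType.
Hypothesis two_neq0 : 2%:R != 0 :> F.
Local Notation chi := (quadchar F).
Local Notation q := (#|F|%:R : int).
Implicit Types x y A : F.

(** The roots [A y] and [1] in [x] coincide only at [y = 1 / A]. *)
Lemma sum_twisted_quadratic_norm_le A (h : F -> F) : A != 0 ->
  `|\sum_y chi (h y) * \sum_x chi ((x - A * y) * (x - 1))| <= 2 * q.
Proof.
move=> A0; apply: (@le_trans _ _ (\sum_(y : F) (1 + (y == A^-1)%:R * q))); last first.
  rewrite big_split /= -mulr_suml sumr_const (sum_indicator F (fun y => y == A^-1)).
  by rewrite (@card1 _ A^-1) mul1r -mulr2n mulr_natl.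
apply: le_trans (ler_norm_sum _ _ _) _; apply: ler_sum => y _.
apply: le_trans (quadcharM_norm_le _ _ _) _.
apply: le_trans (sum_quadchar_quadratic_norm _ two_neq0 _ _) _.
rewrite -(inj_eq (mulfI A0) y) divff //; case: eqP => _.
  by rewrite mul1r lerDr.
by rewrite mul0r addr0.
Qed.

Lemma full_sum_norm_le A : A != 0 ->
  `|\sum_b \sum_c chi ((b ^+ 2 - A * c ^+ 2) * (b ^+ 2 - 1) * (c ^+ 2 - 1))|
  <= `|clausen_sum F A| + 6 * q.
Proof.
move=> A0.
rewrite (sum_sqr F two_neq0 (fun x => \sum_c chi ((x - A * c ^+ 2) * (x - 1) * (c ^+ 2 - 1)))).
(* The weights are 1, [chi y], [chi x] and [chi (x y)]. The third sum runs over [y] inside, using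
   [x - A y = - A (y - x / A)]. Each of the first three is at most [2 q]. *)
have -> : \sum_x (1 + chi x) * (\sum_c chi ((x - A * c ^+ 2) * (x - 1) * (c ^+ 2 - 1)))
  = \sum_y chi (y - 1) * (\sum_x chi ((x - A * y) * (x - 1)))
    + \sum_y chi (y * (y - 1)) * (\sum_x chi ((x - A * y) * (x - 1)))
    + \sum_x chi (- A * x * (x - 1)) * (\sum_y chi ((y - A^-1 * x) * (y - 1)))
    + clausen_sum F A.
  rewrite /clausen_sum; under [X in X + _ + _ + _]eq_bigr do rewrite mulr_sumr.
  under [X in _ + X + _ + _]eq_bigr do rewrite mulr_sumr.
  under [X in _ + _ + X + _]eq_bigr do rewrite mulr_sumr.
  rewrite [X in X + _ + _ + _]exchange_big [X in _ + X + _ + _]exchange_big.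
  rewrite [X in _ + _ + _ + X]exchange_big -!big_split /=; apply: eq_bigr => x _.
  rewrite -!big_split /= (sum_sqr F two_neq0 (fun y => chi ((x - A * y) * (x - 1) * (y - 1)))).
  rewrite mulr_sumr; apply: eq_bigr => y _; rewrite -!quadcharM //.
  have -> : - A * x * (x - 1) * ((y - A^-1 * x) * (y - 1)) = x * ((x - A * y) * (x - 1) * (y - 1)).
    by field.
  rewrite [x * y * _ * _ * _](_ : _ = x * y * ((x - A * y) * (x - 1) * (y - 1))); last by ring.
  rewrite [(y - 1) * _](_ : _ = (x - A * y) * (x - 1) * (y - 1)); last by ring.
  rewrite [y * (y - 1) * _](_ : _ = y * ((x - A * y) * (x - 1) * (y - 1))); last by ring.
  by rewrite !quadcharM //; ring.
have := sum_twisted_quadratic_norm_le _ (fun y => y - 1) A0.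
have := sum_twisted_quadratic_norm_le _ (fun y => y * (y - 1)) A0.
have := sum_twisted_quadratic_norm_le _ (fun x => - A * x * (x - 1)) (invr_neq0 A0).
have triangle (X Y Z S n : int) : `|X| <= 2 * n -> `|Y| <= 2 * n -> `|Z| <= 2 * n ->
  `|Z + Y + X + S| <= `|S| + 6 * n by lia.
exact: triangle.
Qed.
End FullSum.

(** * Derivatives of multiples of a power, multiplicities, and a dimension count *)

Section DerivativeOfPowerMultiple.
Variable F : fieldType.
Implicit Types (f g u v : {poly F}) (n k l : nat) (x a : F).

(** The cofactor of [f ^ (n - k)] in the [k]-th derivative of [f ^ n * u]. Its size admits a bound
    independent of [n], which keeps the linear conditions in Stepanov's method few. *)
Fixpoint powmul_derivn f n k u : {poly F} :=
  if k is k'.+1 then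
    (n - k')%:R *: (f^`() * powmul_derivn f n k' u) + f * (powmul_derivn f n k' u)^`()
  else u.

Lemma powmul_derivnE f n k u : (k <= n)%N ->
  (f ^+ n * u)^`(k) = f ^+ (n - k) * powmul_derivn f n k u.
Proof.
elim: k => [|k IH] kn; first by rewrite subn0.
rewrite derivnS IH ?(ltnW kn) // derivM deriv_exp /= -(subnSK kn) /=.
by rewrite -mul_polyC polyC_natr exprS; ring.
Qed.

Lemma powmul_derivn_linear f n k : linear (powmul_derivn f n k).
Proof.
move=> a u v; elim: k => //= k ->.
by rewrite derivD derivZ -!mul_polyC; ring.
Qed.

(** Each step either multiplies by [f'], of degree at most [d - 1], or multiplies by [f] and
    differentiates the other factor. *)
Lemma size_powmul_derivn f d n k u : (size f <= d.+1)%N ->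
  (size (powmul_derivn f n k u) <= size u + d.-1 * k)%N.
Proof.
move=> sf; elim: k => [|k IH] /=; first by rewrite muln0 addn0.
set w := powmul_derivn f n k u in IH *.
have [->|w0] := eqVneq w 0; first by rewrite deriv0 !mulr0 scaler0 addr0 size_poly0.
have [->|f0] := eqVneq f 0; first by rewrite deriv0 !mul0r scaler0 addr0 size_poly0.
have sw : (0 < size w)%N by rewrite size_poly_gt0.
have sf' := lt_size_deriv f0; have sw' := lt_size_deriv w0.
have [s1 s2] := (size_polyMleq f^`() w, size_polyMleq f w^`()).
rewrite mulnS; move: (d.-1 * k)%N IH => e IH.
apply: leq_trans (size_polyD _ _) _; rewrite geq_max; apply/andP; split.
  apply: leq_trans (size_scale_leq _ _) _; apply: leq_trans s1 _.
  have lin (i j h : nat) : (i < j -> j <= d.+1 -> h <= size u + e -> (i + h).-1 <= size u + (d.-1 + e))%N by lia.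
  exact: lin sf' sf IH.
apply: leq_trans s2 _.
have lin (i j h : nat) : (j <= d.+1 -> h <= size u + e -> i < h -> (j + i).-1 <= size u + (d.-1 + e))%N by lia.
exact: lin sf IH sw'.
Qed.

Lemma root_powmul_derivn f n k u x : root f x -> (k <= n)%N ->
  (powmul_derivn f n k u).[x] = (n ^_ k)%:R * f^`().[x] ^+ k * u.[x].
Proof.
move=> /eqP fx; elim: k => [|k IH] kn /=; first by rewrite !mul1r.
rewrite hornerD hornerZ !hornerM fx mul0r addr0 IH ?(ltnW kn) //.
by rewrite ffactnSr natrM exprS; ring.
Qed.

(** If [g = (X - x) ^ l * s], then its [l]-th derivative at [x] is [l! * s(x)], so one more
    vanishing derivative gives one more factor as long as [l!] is invertible. *)
Lemma dvdp_XsubC_exp l g x :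
  (forall k, (k < l)%N -> (k`!)%:R != 0 :> F) ->
  (forall k, (k < l)%N -> (g^`(k)).[x] = 0) -> ('X - x%:P) ^+ l %| g.
Proof.
elim: l => [|l IH] fact0 g0; first by rewrite dvd1p.
have /dvdpP[s gE] : ('X - x%:P) ^+ l %| g.
  by apply: IH => k kl; [apply: fact0 | apply: g0]; apply: ltnW.
have := g0 l (ltnSn l); rewrite gE mulrC powmul_derivnE // subnn mul1r.
rewrite root_powmul_derivn ?root_XsubC // derivXsubC hornerC expr1n mulr1 ffactnn.
move/eqP; rewrite mulf_eq0 (negPf (fact0 _ _)) //= => sx.
by rewrite exprSr dvdp_mul ?dvdp_XsubCl.
Qed.

Lemma prod_XsubC_exp_dvdp l g (rs : seq F) : uniq rs ->
  (forall x, x \in rs -> ('X - x%:P) ^+ l %| g) ->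
  \prod_(x <- rs) ('X - x%:P) ^+ l %| g.
Proof.
elim: rs => [|x rs IH] /=; first by rewrite big_nil dvd1p.
case/andP=> xrs urs dv; rewrite big_cons Gauss_dvdp.
  by rewrite dv ?mem_head // IH // => y yrs; apply: dv; rewrite inE yrs orbT.
rewrite coprimep_expl // coprimep_sym coprimep_XsubC rootE horner_prod.
rewrite prodf_seq_neq0; apply/allP => y yrs /=; rewrite !hornerE expf_neq0 // subr_eq0.
by apply: contraNneq xrs => ->.
Qed.

Lemma size_seq_roots_le l g (rs : seq F) : g != 0 -> uniq rs ->
  (forall k, (k < l)%N -> (k`!)%:R != 0 :> F) ->
  (forall x k, x \in rs -> (k < l)%N -> (g^`(k)).[x] = 0) ->
  (l * size rs < size g)%N.
Proof.
move=> g0 urs fact0 root_g.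
have /dvdp_leq-/(_ g0) : \prod_(x <- rs) ('X - x%:P) ^+ l %| g.
  by apply: prod_XsubC_exp_dvdp => // x xrs; apply: dvdp_XsubC_exp => // k; apply: root_g.
rewrite prodrXl; apply: leq_trans.
set P := \prod_(x <- rs) _.
have P0 : P != 0 by rewrite -size_poly_gt0 size_prod_XsubC.
have := size_exp P l; rewrite size_prod_XsubC /= mulnC => <-.
by rewrite prednK // size_poly_gt0 expf_neq0.
Qed.

(** The conditions are [l * W] linear equations, one per coefficient, in the [m * n] entries of
    [A]. *)
Lemma linear_polys_kernel m n l W (T : nat -> 'M[F]_(m, n) -> {poly F}) :
  (forall k, linear (T k)) ->
  (forall k A, (k < l)%N -> (size (T k A) <= W)%N) -> (l * W < m * n)%N ->
  exists2 A, A != 0 & forall k, (k < l)%N -> T k A = 0.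
Proof.
move=> linT sizeT lt_dim.
pose f A : 'M[F]_(l, W) := \matrix_(k, i) (T k A)`_i.
have f_lin : linear f.
  by move=> a A B; apply/matrixP=> k i; rewrite !mxE linT coefD coefZ.
pose fL : {linear 'M[F]_(m, n) -> 'M[F]_(l, W)} :=
  HB.pack f (GRing.isLinear.Build _ _ _ _ f f_lin).
have : kermx (lin_mx fL) != 0.
  rewrite kermx_eq0 /row_free neq_ltn (leq_ltn_trans (rank_leq_col _)) //.
case/rowV0Pn => u /sub_kermxP uf u0; exists (vec_mx u).
  by rewrite (can2_eq vec_mxK mxvecK) linear0.
move=> k kl; apply/polyP => i; rewrite coef0.
have [Wi|iW] := leqP W i; first by rewrite nth_default // (leq_trans (sizeT _ _ kl)).
move: uf; rewrite mul_rV_lin => /(canRL mxvecK); rewrite linear0.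
by move/matrixP/(_ (Ordinal kl) (Ordinal iW)); rewrite !mxE.
Qed.
End DerivativeOfPowerMultiple.

(** * Stepanov's auxiliary polynomial *)

Section Stepanov.
Variables (F : finFieldType) (M : nat) (f : {poly F}).
Local Notation p := #|F|.
Hypotheses (p_prime : prime p) (pE : p = M.*2.+1).
Hypotheses (size_f : size f = 4%N) (f0 : f.[0] != 0).
Implicit Types (r s u : {poly F}) (x : F) (D J l n : nat).

Lemma card_prime_pchar : p \in [pchar F].
Proof. by apply: (card_finPcharP (n := 1)); rewrite ?expn1. Qed.

Lemma factr_neq0 k : (k < p)%N -> (k`!)%:R != 0 :> F.
Proof.
elim: k => [|k IH] kp; first by rewrite oner_neq0.
rewrite factS natrM mulf_neq0 ?IH ?(ltnW kp) // -(dvdn_pcharf card_prime_pchar).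
by rewrite gtnNdvd.
Qed.

(* Modulo ['X^p] the relation gives [r ^+ 2 * f = f.[0] *: s ^+ 2] since
   [f ^+ p] is congruent to [f.[0]]; the degrees have different parities. *)
Lemma add_mul_expf_eq0 D r s u : (D.*2.+2 <= p)%N -> (size r <= D)%N -> (size s <= D)%N ->
  r + s * f ^+ M = u * 'X^p -> r = 0 /\ s = 0.
Proof.
move=> Dp rD sD E.
have [g fE] : exists g, f = f.[0]%:P + g * 'X.
  exists (drop_poly 1 f); rewrite -[LHS](poly_take_drop 1) expr1; congr (_ + _).
  by apply/polyP => i; rewrite coef_take_poly coefC horner_coef0; case: i.
have fp : f ^+ p = f.[0]%:P + g ^+ p * 'X^p.
  rewrite {1}fE exprDn_pchar ?exprMn -?polyC_exp ?expf_card //.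
  by rewrite (eq_pnat _ (pchar_poly F)) pnatE // card_prime_pchar.
have : r ^+ 2 * f - f.[0] *: s ^+ 2
     = (u * (r - s * f ^+ M) * f + s ^+ 2 * g ^+ p) * 'X^p.
  have -> : (u * (r - s * f ^+ M) * f + s ^+ 2 * g ^+ p) * 'X^p
    = u * 'X^p * (r - s * f ^+ M) * f + s ^+ 2 * (g ^+ p * 'X^p) by ring.
  have -> : g ^+ p * 'X^p = f ^+ M ^+ 2 * f - f.[0]%:P.
    by rewrite -exprM muln2 -exprSr -pE fp addrC addKr.
  by rewrite -E -mul_polyC; ring.
(* The left side has size at most [2 D + 2 <= p], so truncation leaves it unchanged. *)
move/(congr1 (take_poly p)); rewrite take_polyMXn_0 take_poly_id => [/eqP|]; last first.
  apply: leq_trans (size_polyD _ _) _; rewrite geq_max size_polyN !expr2; apply/andP; split.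
    have := size_polyMleq (r * r) f; have := size_polyMleq r r; rewrite size_f.
    move: Dp rD; rewrite pE; lia.
  apply: leq_trans (size_scale_leq _ _) _; apply: leq_trans (size_polyMleq _ _) _.
  move: Dp sD; rewrite pE; move: (size s) => i; lia.
rewrite subr_eq0 => /eqP rs.
have f_neq0 : f != 0 by rewrite -size_poly_gt0 size_f.
have [r0|r0] := eqVneq r 0.
  split=> //; move/esym/eqP: rs; rewrite r0 expr0n mul0r scaler_eq0 (negPf f0) sqrf_eq0.
  by move/eqP.
have [s0|s0] := eqVneq s 0.
  by move/eqP: rs; rewrite s0 expr0n scaler0 mulf_eq0 sqrf_eq0 (negPf r0) (negPf f_neq0).
move/(congr1 (fun v : {poly F} => size v)): rs; rewrite size_scale // size_mul ?expf_neq0 //.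
rewrite !expr2 !size_mul // size_f.
by move: r0 s0; rewrite -!size_poly_gt0; move: (size r) (size s) => i j; lia.
Qed.

(** The term [j = 0] is a multiple of [X ^ p], hence vanishes; divide the rest by [X ^ p] and
    repeat. This keeps the auxiliary polynomial nonzero. *)
Lemma stepanov_poly_indep D J (r s : 'I_J -> {poly F}) : (D.*2.+2 <= p)%N ->
  (forall j, size (r j) <= D)%N -> (forall j, size (s j) <= D)%N ->
  \sum_j (r j + s j * f ^+ M) * 'X^(p * j) = 0 -> forall j, r j = 0 /\ s j = 0.
Proof.
move=> Dp; elim: J r s => [|J IH] r s rD sD; first by move=> _ [].
rewrite big_ord_recl muln0 mulr1.
have -> : \sum_(i < J) (r (lift ord0 i) + s (lift ord0 i) * f ^+ M) * 'X^(p * lift ord0 i)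
  = (\sum_(i < J) (r (lift ord0 i) + s (lift ord0 i) * f ^+ M) * 'X^(p * i)) * 'X^p.
  rewrite mulr_suml; apply: eq_bigr => i _.
  by rewrite lift0 mulnS addnC exprD mulrA.
set t := \sum_(i < J) _ => E.
have [r0 s0] : r ord0 = 0 /\ s ord0 = 0.
  by apply: (add_mul_expf_eq0 D _ _ (- t)) => //; apply/eqP; rewrite mulNr -addr_eq0 E.
move: E; rewrite r0 s0 mul0r !add0r => /eqP; rewrite mulf_eq0 expf_eq0 polyX_eq0 andbF orbF.
move=> /eqP t0 j; have [->//|[i ->]] : j = ord0 \/ exists i, j = lift ord0 i.
  by case: (unliftP ord0 j) => [i ->|->]; [right; exists i | left].
exact: (IH (fun i => r (lift ord0 i)) (fun i => s (lift ord0 i))).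
Qed.

Lemma derivn_mulXp k u j : (u * 'X^(p * j))^`(k) = u^`(k) * 'X^(p * j).
Proof.
elim: k => // k IH; rewrite !derivnS IH derivM derivXn mulrnA (mulrn_pchar (p := p)).
  by rewrite mul0rn mulr0 addr0.
by rewrite pchar_poly card_prime_pchar.
Qed.

(** A nonzero [P], the sum of [(r_j + s_j f ^ M) X ^ (p j)], is chosen so that [f ^ l * P] vanishes
    to order [l] at every point of [xs]; its degree then bounds [l * size xs]. The strict inequality
    among the hypotheses says that unknowns outnumber equations. *)
Lemma stepanov_count_lt (a : F) l n D (xs : seq F) : uniq xs ->
  {in xs, forall x, f.[x] ^+ M = a} -> (l <= p)%N -> (D.*2.+2 <= p)%N ->
  (l * (D + 2 * l + n.+1) < n.+1 * (D + D))%N ->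
  (l * size xs <= 3 * (l + M) + D + p * n)%N.
Proof.
move=> uxs xsa lp Dp count.
pose r (A : 'M[F]_(n.+1, D + D)) j := rVpoly (lsubmx (row j A)).
pose s (A : 'M[F]_(n.+1, D + D)) j := rVpoly (rsubmx (row j A)).
have r_lin j : linear (r^~ j) by move=> b A B; rewrite /r !linearP.
have s_lin j : linear (s^~ j) by move=> b A B; rewrite /s !linearP.
have rD A j : (size (r A j) <= D)%N by apply: size_poly.
have sD A j : (size (s A j) <= D)%N by apply: size_poly.
(* On [xs] one may replace [f ^ M] by [a] and [X ^ p] by [X]. After removing [f ^ (l - k)], the
   [k]-th derivative becomes [T k A], of far smaller degree; it is made zero as a polynomial. *)
pose T k A := \sum_(j < n.+1) (powmul_derivn F f l k (r A j)
                + a *: powmul_derivn F f (l + M) k (s A j)) * 'X^j.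
have [|k A kl|A A0 TA] := linear_polys_kernel F n.+1 (D + D) l (D + 2 * l + n.+1) T _ _ count.
- move=> k b A B; rewrite /T scaler_sumr -big_split; apply: eq_bigr => j _ /=.
  by rewrite r_lin s_lin !powmul_derivn_linear -!mul_polyC; ring.
- apply: leq_trans (size_sum _ _ _) _; apply/bigmax_leqP => j _.
  apply: leq_trans (size_polyMleq _ _) _; rewrite size_polyXn.
  have sz m u : (size u <= D -> size (powmul_derivn F f m k u) <= D + 2 * l)%N.
    by move=> uD; apply: leq_trans (size_powmul_derivn _ _ 3 _ _ _ _) _; rewrite ?size_f // leq_add // leq_mul // ltnW.
  suff : (size (powmul_derivn F f l k (r A j) + a *: powmul_derivn F f (l + M) k (s A j))%R
          <= D + 2 * l)%N by have := ltn_ord j; move: (size _) => i; lia.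
  apply: leq_trans (size_polyD _ _) _; rewrite geq_max sz //=.
  by apply: leq_trans (size_scale_leq _ _) _; apply: sz.
pose P := \sum_(j < n.+1) (r A j + s A j * f ^+ M) * 'X^(p * j).
have P0 : P != 0.
  apply: contraNneq A0 => P0; have rs0 := stepanov_poly_indep D _ (r A) (s A) Dp (rD A) (sD A) P0.
  apply/eqP/row_matrixP => j; rewrite row0 -[row j A]hsubmxK.
  have [rj sj] := rs0 j; rewrite -[lsubmx _]rVpolyK -[rsubmx _]rVpolyK.
  by rewrite [rVpoly (lsubmx _)]rj [rVpoly (rsubmx _)]sj !linear0 row_mx0.
have f_neq0 : f != 0 by rewrite -size_poly_gt0 size_f.
rewrite -ltnS; apply: leq_trans (_ : size (f ^+ l * P)%R <= _)%N.
  apply: size_seq_roots_le => //.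
  - by rewrite mulf_neq0 ?expf_neq0.
  - by move=> k kl; apply: factr_neq0; apply: leq_trans lp.
  move=> x k xxs kl.
  have -> : f ^+ l * P = \sum_(j < n.+1) (f ^+ l * r A j + f ^+ (l + M) * s A j) * 'X^(p * j).
    by rewrite mulr_sumr; apply: eq_bigr => j _; rewrite exprD; ring.
  rewrite linear_sum /= horner_sum.
  transitivity (f.[x] ^+ (l - k) * (T k A).[x]); last by rewrite TA // horner0 mulr0.
  rewrite horner_sum mulr_sumr; apply: eq_bigr => j _.
  rewrite derivn_mulXp linearD /= !powmul_derivnE ?(leq_trans (ltnW kl)) ?leq_addr //.
  rewrite -addnBAC ?(ltnW kl) // exprD !hornerE -(xsa x xxs) exprM expf_card /=.
  by rewrite mulrDr !mulrA.
have sP : (size P <= D + 3 * M + p * n)%N.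
  apply: leq_trans (size_sum _ _ _) _; apply/bigmax_leqP => j _.
  apply: leq_trans (size_polyMleq _ _) _; rewrite size_polyXn addnS /=.
  apply: leq_add; last by rewrite leq_mul2l -ltnS ltn_ord orbT.
  apply: leq_trans (size_polyD _ _) _; rewrite geq_max (leq_trans (rD A j)) ?leq_addr //=.
  apply: leq_trans (size_polyMleq _ _) _; have := sD A j.
  have := size_poly_exp_leq f M; rewrite size_f; move: (size _) (size _) => i h; lia.
apply: leq_trans (size_polyMleq _ _) _.
have := size_poly_exp_leq f l; rewrite size_f; move: sP; move: (size _) (size _) => i h; lia.
Qed.
End Stepanov.

(** * Square root cancellation in cubic character sums *)

Section CubicSums.
Variable F : finFieldType.
Hypotheses (p_prime : prime #|F|) (two_neq0 : 2%:R != 0 :> F).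
Local Notation chi := (quadchar F).
Implicit Types (f : {poly F}) (x : F).

Lemma sum_quadchar_count (h : F -> F) :
  \sum_x chi (h x) = (#|[pred x | chi (h x) == 1]|)%:R - (#|[pred x | chi (h x) == -1]|)%:R.
Proof.
rewrite -!sum_indicator -sumrB; apply: eq_bigr => x _ /=; rewrite /quadchar.
by case: (h x == 0) => //=; case: ifP.
Qed.

Lemma card_quadchar_count (h : F -> F) :
  (#|[pred x | chi (h x) == 1%R]| + #|[pred x | chi (h x) == -1%R]| + #|[pred x | h x == 0%R]|)%N
  = #|F|.
Proof.
apply/eqP; rewrite -(eqr_nat int) !natrD -!sum_indicator -!big_split /=.
apply/eqP; apply: eq_bigr => x _; rewrite /quadchar.
by case: (h x == 0) => //=; case: ifP.
Qed.

Lemma card_roots_cubic f : size f = 4%N -> (#|[pred x | f.[x] == 0%R]| <= 3)%N.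
Proof.
move=> sf; rewrite -ltnS -sf cardE; apply: max_poly_roots.
- by rewrite -size_poly_gt0 sf.
- by apply/allP => x; rewrite mem_enum inE.
- exact: enum_uniq.
Qed.

Lemma sqrt_bracket m : exists n, (16 * n ^ 2 <= m < 16 * n.+1 ^ 2)%N.
Proof.
elim: m => [|m [n nm]]; first by exists 0%N.
have [e|ne] := eqVneq m.+1 (16 * n.+1 ^ 2)%N; last by exists n; lia.
by exists n.+1; rewrite e leqnn ltn_mul2l ltn_sqr ltnSn.
Qed.

(** Since the counts add up to [p], upper bounds on both [N1] and [Nm] also bound them below, giving
    a difference of at most [2 p / n + 9]. *)
Lemma sqr_le_of_count (n p N1 Nm N0 : nat) : (0 < n)%N -> (0 < p)%N -> (p < 16 * n.+1 ^ 2)%N ->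
  (N1 + Nm + N0)%N = p -> (N0 <= 3)%N ->
  (2 * n * N1 <= 6 * n + 2 * p + p * n)%N -> (2 * n * Nm <= 6 * n + 2 * p + p * n)%N ->
  (N1%:R - Nm%:R : int) ^+ 2 <= 674 * p%:R.
Proof.
move=> n0 p0 pn Np N03 N1n Nmn.
have p64 : (p <= 64 * n ^ 2)%N by nia.
have nT : `|n%:Z * (N1%:Z - Nm%:Z)| <= 2 * p%:Z + 9 * n%:Z by nia.
have n2 : 0 < n%:Z ^+ 2 by rewrite exprn_gt0.
rewrite !natz -(ler_pM2l n2) -exprMn -real_normK ?num_real //.
apply: (@le_trans _ _ ((2 * p%:Z + 9 * n%:Z) ^+ 2)); first by rewrite ler_sqr ?nnegrE //; lia.
have p64' : p%:Z <= 64 * n%:Z ^+ 2 by lia.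
have p1 : 1 <= p%:Z by lia.
(* This gives [(2 p + 9 n) ^ 2 <= 8 p ^ 2 + 162 n ^ 2]; with [p <= 64 n ^ 2] and [1 <= p] the
   constant is [8 * 64 + 162 = 674]. *)
have sq : 0 <= (2 * p%:Z - 9 * n%:Z) ^+ 2 by apply: sqr_ge0.
have pp : p%:Z * p%:Z <= p%:Z * (64 * n%:Z ^+ 2) by rewrite ler_wpM2l.
have npp : n%:Z ^+ 2 <= n%:Z ^+ 2 * p%:Z by rewrite ler_peMr // ltW.
rewrite !expr2 in sq pp npp *; lia.
Qed.

Lemma sum_cubic_sqr_le_aux f : size f = 4%N -> f.[0] != 0 -> (16 <= #|F|)%N ->
  (\sum_x chi f.[x]) ^+ 2 <= 674 * #|F|%:R.
Proof.
move=> sf f0 p16; have [n /andP[np pn]] := sqrt_bracket #|F|.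
set M := #|[pred x : F | chi x == 1]|.
have pE : #|F| = M.*2.+1 := card_finField_half F two_neq0.
have n0 : (0 < n)%N by case: n np pn => // _; rewrite ltnNge p16.
have bound (e : int) : (#|[pred x | chi f.[x] == e]| * (2 * n) <=  6 * n + 2 * #|F| + #|F| * n)%N
    \/ (e != 1 /\ e != -1).
  have [ee|] := boolP ((e == 1) || (e == -1)); last by rewrite negb_or => /andP; right.
  left; rewrite mulnC cardE.
  (* Stepanov is applied with multiplicity [l = 2 n] and [D = M - 1], the largest value allowed. The
     dimension condition becomes [5 n ^ 2 + n + 1 < M], a consequence of [16 n ^ 2 <= #|F|]. *)
  apply: leq_trans (_ : 3 * (2 * n + M) + M.-1 + #|F| * n <= _)%N; last by rewrite pE; nia.
  apply: (stepanov_count_lt F M f p_prime pE sf f0 e%:~R).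
  - exact: enum_uniq.
  - move=> x; rewrite mem_enum inE => /eqP <-; rewrite quadchar_euler //.
    by rewrite pE /= uphalf_double.
  - by nia.
  - by rewrite pE; nia.
  - by nia.
rewrite sum_quadchar_count.
apply: sqr_le_of_count n0 (leq_trans _ p16) pn (card_quadchar_count _) (card_roots_cubic f sf) _ _ => //.
  by case: (bound 1) => [|[]//]; rewrite mulnC.
by case: (bound (-1)) => [|[]//]; rewrite mulnC.
Qed.

(** Below 16 the trivial bound suffices. Otherwise [f], having at most three roots, can be
    translated so that [f.[0] != 0]. *)
Lemma sum_cubic_sqr_le f : size f = 4%N -> (\sum_x chi f.[x]) ^+ 2 <= 674 * #|F|%:R.
Proof.
move=> sf; have [p16|p16] := leqP 16 #|F|; last first.
  have := sum_norm_le F (fun x => chi f.[x]) 1 (fun x => quadchar_norm_le1 F _).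
  move: (\sum_x _) #|F| p16 => T p p16; rewrite !natz => Tp.
  rewrite -real_normK ?num_real //; move: (normr_ge0 T) Tp; move: `|T| => t t0 tp.
  by rewrite expr2; nia.
have [h fh] : exists h, f.[h] != 0.
  apply/existsP; apply: contraTT p16; rewrite negb_exists => /forallP fz.
  have := card_roots_cubic f sf; rewrite eq_cardT -?cardT => [le3|].
    by rewrite -ltnNge; apply: leq_trans le3 _.
  by move=> x; rewrite inE; have := fz x; rewrite negbK.
rewrite (reindex_inj (addIr h)) /=.
have -> : \sum_x chi f.[x + h] = \sum_x chi (f \Po ('X + h%:P)).[x].
  by apply: eq_bigr => x _; rewrite horner_comp !hornerE.
apply: sum_cubic_sqr_le_aux => //; last by rewrite horner_comp !hornerE.
by rewrite size_comp_poly2 // size_XaddC.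
Qed.
End CubicSums.

Lemma full_sum_bound (F : finFieldType) (A : F) : prime #|F| -> 2%:R != 0 :> F -> A != 0 ->
  `|\sum_b \sum_c quadchar F ((b ^+ 2 - A * c ^+ 2) * (b ^+ 2 - 1) * (c ^+ 2 - 1))|
  <= 687 * #|F|%:R.
Proof.
move=> p_prime two_neq0 A0.
(* Taking [m = c = 1 - A] works unless [A = 1], where [c] would vanish. *)
have [m [c [c0 mE]]] : exists m c, c != 0 /\ m ^+ 2 = (1 - A) * c.
  have [A1|A1] := eqVneq A 1.
    by exists 0, 1; rewrite oner_neq0 A1 subrr mul0r expr0n.
  by exists (1 - A), (1 - A); rewrite subr_eq0 eq_sym A1 expr2.
pose f := ('X - m%:P) * ('X^2 - c%:P).
have f4 : size f = 4%N.
  by rewrite size_Mmonic ?monicXnsubC ?polyXsubC_eq0 // size_XsubC size_XnsubC.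
have := full_sum_norm_le F two_neq0 A A0.
have := clausen_sum_norm_le F two_neq0 A c m A0 c0 mE.
have := sum_cubic_sqr_le F p_prime two_neq0 f f4.
under eq_bigr do rewrite !hornerE.
(* [687 = 674 + 7 + 6]. *)
have triangle (S S4 T n : int) : T <= 674 * n -> S4 <= T + 7 * n -> S <= S4 + 6 * n ->
  S <= 687 * n by lia.
exact: triangle.
Qed.

(** * From Legendre symbols of integers to the character of ['F_p] *)

Section LegendreSymbol.
Variable p : nat.
Hypothesis p_prime : prime p.

Lemma intr_Fp_eq0 (a : int) : (a%:~R == 0 :> 'F_p) = (p%:Z %| a)%Z.
Proof. by rewrite (dvdz_pcharf (pchar_Fp p_prime)). Qed.

Lemma natr_ord_bij : bijective (fun i : 'I_p => (i : nat)%:R : 'F_p).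
Proof.
apply: inj_card_bij; last by rewrite card_Fp // card_ord.
move=> i j /(congr1 (fun x : 'F_p => x : nat)); rewrite !val_Fp_nat // !modn_small //.
exact: val_inj.
Qed.

Lemma legendreE (a : int) : legendre a p = quadchar 'F_p a%:~R.
Proof.
rewrite /legendre /quadchar intr_Fp_eq0; case: ifP => // _; congr (if _ then _ else _).
apply/existsP/existsP => [[i]|[y]].
  by rewrite -intr_Fp_eq0 rmorphB rmorphXn /= subr_eq0 => ?; exists (i : nat)%:R.
have [g _ gK] := natr_ord_bij; rewrite -(gK y) => y2; exists (g y).
by rewrite -intr_Fp_eq0 rmorphB rmorphXn /= subr_eq0.
Qed.

Lemma sum_Fp_nonzero (G : 'F_p -> int) :
  \sum_(1 <= b < p) G b%:R = \sum_x G x - G 0.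
Proof.
rewrite (reindex _ (onW_bij _ natr_ord_bij)) /= -(big_mkord predT (fun b => G b%:R)).
by rewrite [in RHS]big_ltn ?prime_gt0 // mulr0n [RHS]addrC addKr.
Qed.

(** Restoring the row and the column at zero costs at most [p] each, and their common corner at most
    [1 <= p]. *)
Lemma double_sum_Fp_nonzero_le (H : 'F_p -> 'F_p -> int) :
  (forall x y, `|H x y| <= 1) ->
  `|\sum_(1 <= b < p) \sum_(1 <= c < p) H b%:R c%:R|
  <= `|\sum_x \sum_y H x y| + 3 * p%:R.
Proof.
move=> H1; rewrite (eq_bigr (fun b : nat => \sum_y H b%:R y - H b%:R 0)); last first.
  by move=> b _; rewrite (sum_Fp_nonzero (H b%:R)).
rewrite (sum_Fp_nonzero (fun x => \sum_y H x y - H x 0)) sumrB.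
have := sum_norm_le 'F_p (fun x => H x 0) 1 (H1^~ 0).
have := sum_norm_le 'F_p (H 0) 1 (H1 0).
have := H1 0 0; have := prime_gt0 p_prime; rewrite card_Fp // => p0.
have triangle (S X Y Z n : int) : 1 <= n -> `|Z| <= 1 -> `|Y| <= 1 * n -> `|X| <= 1 * n ->
  `|S - X - (Y - Z)| <= `|S| + 3 * n by lia.
by apply: triangle; rewrite ler1n.
Qed.
End LegendreSymbol.

Theorem theorem3 :
  exists K : rat, 0 < K /\
    forall (p : nat) (a : int), prime p -> odd p -> ~~ (p%:Z %| a)%Z ->
      `| (\sum_(1 <= b < p) \sum_(1 <= c < p)
            legendre ((b%:Z) ^+ 2 - a ^+ 2 * (c%:Z) ^+ 2) p
            * legendre ((b%:Z) ^+ 2 - 1) p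
            * legendre ((c%:Z) ^+ 2 - 1) p)%:~R | <= K * p%:R.
Proof.
(* [690 = 687 + 3], the 3 paying for the terms with [b = 0] or [c = 0]. *)
exists 690%:R; split=> [|p a p_prime p_odd a0]; first by rewrite ltr0n.
have two_neq0 : 2%:R != 0 :> 'F_p.
  rewrite -(dvdn_pcharf (pchar_Fp p_prime)) dvdn_prime2 //.
  by apply: contraTneq p_odd => ->.
have A0 : (a%:~R : 'F_p) ^+ 2 != 0 by rewrite expf_neq0 // intr_Fp_eq0.
pose H (x y : 'F_p) :=
  quadchar 'F_p ((x ^+ 2 - a%:~R ^+ 2 * y ^+ 2) * (x ^+ 2 - 1) * (y ^+ 2 - 1)).
rewrite (eq_bigr (fun b : nat => \sum_(1 <= c < p) H b%:R c%:R)) => [|b _]; last first.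
  apply: eq_bigr => c _; rewrite !legendreE // -!quadcharM //; congr quadchar.
  by rewrite !(rmorphB, rmorphM, rmorphXn, rmorph1).
have : `|\sum_(1 <= b < p) \sum_(1 <= c < p) H b%:R c%:R| <= 690 * p%:R :> int.
  apply: le_trans (double_sum_Fp_nonzero_le p p_prime H _) _ => [x y|].
    exact: quadchar_norm_le1.
  have := full_sum_bound 'F_p _ _ two_neq0 A0; rewrite card_Fp // => /(_ p_prime) full.
  apply: le_trans (lerD full (lexx _)) _.
  by rewrite -mulrDl.
by rewrite -(ler_int rat) -intr_norm rmorphM /= !natz.
Qed.
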